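(* Let $D$ be a positive integer and let $\Gamma\subseteq\mathbb{R}^D$ be orthosymmetric, compact and convex. Then for every $\epsilon>0$, $$n_{\mathrm{gof}}\Big(\Gamma,\frac{\epsilon}{\sqrt2}\Big)^2\ge \frac{1}{64\log(2D)}\cdot\frac{n_{\mathrm{est}}(\Gamma,\epsilon)}{\epsilon^2}.$$
   Context: A set $\Gamma\subseteq\mathbb{R}^D$ is orthosymmetric if for every $\boldsymbol\theta=(\theta_1,\dots,\theta_D)\in\Gamma$ and every sign vector $(\epsilon_1,\dots,\epsilon_D)\in\{-1,1\}^D$, $(\epsilon_1\theta_1,\dots,\epsilon_D\theta_D)\in\Gamma$. Model: $\{\mathcal N(\boldsymbol\theta,I_D):\boldsymbol\theta\in\Gamma\}$. $n_{\mathrm{est}}(\Gamma,\epsilon)$ is the smallest $n$ such that from $n$ i.i.d. samples of $\mathcal N(\boldsymbol\theta,I_D)$ some estimator $\hat{\boldsymbol\theta}$ achieves $\sup_{\boldsymbol\theta\in\Gamma}\mathbb E\|\hat{\boldsymbol\theta}-\boldsymbol\theta\|_2^2\le\epsilon^2$. $n_{\mathrm{gof}}(\Gamma,\epsilon)$ is the smallest $n$ such that from $n$ i.i.d. samples of $\mathcal N(\boldsymbol\theta,I_D)$, $\boldsymbol\theta\in\Gamma$, some test $\psi\in\{0,1\}$ of $H_0:\boldsymbol\theta=\mathbf 0$ vs $H_1:\boldsymbol\theta\in\Gamma,\|\boldsymbol\theta\|_2\ge\epsilon$ has $\mathbb P_{\mathbf 0}(\psi=1)\le1/4$ and $\sup_{H_1}\mathbb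 P_{\boldsymbol\theta}(\psi=0)\le 1/4$. *)

(* Defs.v *)
From HB Require Import structures.
From mathcomp Require Import all_boot all_order all_algebra.
From mathcomp Require Import all_classical all_reals all_analysis.
Set Implicit Arguments. Unset Strict Implicit. Unset Printing Implicit Defensive.
Import Order.TTheory GRing.Theory Num.Theory.
Import numFieldNormedType.Exports.
Local Open Scope classical_set_scope.
Local Open Scope ring_scope.

Section gaussian_model.
Variable R : realType.

(* Iterated integral over k.-tuples, using the integrator I for each factor.
   For nonnegative measurable integrands this equals (Tonelli) the integral
   against the k-fold product measure. *)
Fixpoint iint (T : Type) (I : (T -> \bar R) -> \bar R) (k : nat)
  : (k.-tuple T -> \bar R) -> \bar R :=
  match k return (k.-tuple T -> \bar R) -> \bar R with
  | 0 => fun g => g [tuple]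
  | k'.+1 => fun g => I (fun x => iint I (fun t => g (cons_tuple x t)))
  end.

Definition std_normal_int (h : R -> \bar R) : \bar R :=
  (\int[normal_prob (0:R) 1]_x h x)%E.

Definition shift (D : nat) (theta : 'rV[R]_D) (z : D.-tuple R) : D.-tuple R :=
  [tuple theta ord0 i + tnth z i | i < D].

(* Integral against N(theta, I_D) on R^D (vectors represented as D-tuples). *)
Definition gauss_vec_int (D : nat) (theta : 'rV[R]_D)
  (h : D.-tuple R -> \bar R) : \bar R :=
  iint std_normal_int (fun z => h (shift theta z)).

(* Expectation of g(X_1,...,X_n), X_j i.i.d. N(theta, I_D);
   used for nonnegative measurable g only. *)
Definition gauss_sample_exp (D : nat) (theta : 'rV[R]_D) (n : nat)
  (g : n.-tuple (D.-tuple R) -> \bar R) : \bar R :=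
  iint (gauss_vec_int theta) g.

Definition sqdist (D : nat) (x : D.-tuple R) (theta : 'rV[R]_D) : R :=
  \sum_(i < D) (tnth x i - theta ord0 i) ^+ 2.

Definition norm2 (D : nat) (theta : 'rV[R]_D) : R :=
  Num.sqrt (\sum_(i < D) theta ord0 i ^+ 2).

Definition orthosymmetric (D : nat) (Gamma : set 'rV[R]_D) : Prop :=
  forall theta, Gamma theta ->
  forall s : 'I_D -> R, (forall i, s i = 1 \/ s i = -1) ->
  Gamma (\row_i (s i * theta ord0 i)).

Definition est_ok (D : nat) (Gamma : set 'rV[R]_D) (eps : R) (n : nat) : Prop :=
  exists f : n.-tuple (D.-tuple R) -> D.-tuple R,
    measurable_fun setT f /\
    forall theta, Gamma theta ->
      (gauss_sample_exp theta (fun X => (sqdist (f X) theta)%:E) <= (eps ^+ 2)%:E)%E.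

Definition gof_ok (D : nat) (Gamma : set 'rV[R]_D) (eps : R) (n : nat) : Prop :=
  exists psi : n.-tuple (D.-tuple R) -> bool,
    measurable (psi @^-1` [set true]) /\
    (gauss_sample_exp (0 : 'rV[R]_D) (fun X => ((psi X)%:R : R)%:E)
       <= (1 / 4 : R)%:E)%E /\
    forall theta, Gamma theta -> eps <= norm2 theta ->
      (gauss_sample_exp theta (fun X => ((~~ psi X)%:R : R)%:E)
         <= (1 / 4 : R)%:E)%E.

End gaussian_model.

Definition is_least_nat (P : nat -> Prop) (n : nat) : Prop :=
  P n /\ forall m, P m -> (n <= m)%N.

(* Main.v *)
(** Write n for the number of samples of a valid test, L = log (2D).

    Testing.  For theta in Gamma with |theta| >= eps / sqrt 2, randomise the
    signs of theta.  The second moment of the likelihood ratio of the mixture is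
    prod_i cosh (n theta_i^2) <= exp (2 n^2 sum_i theta_i^4), and a valid test
    forces it to be at least 9/4, hence n^2 sum_i theta_i^4 > 1/4.

    Truncation.  Gamma is solid, so this applies to truncations of its points,
    rescaled to norm eps / sqrt 2.  For t^2 = 1 / (2 n^2 eps^2) it follows that
    sum_i min (|theta_i|, t)^2 <= eps^2 / 2 on all of Gamma.

    Estimation.  Soft thresholding at level t / 2 of the mean of about
    64 L eps^2 n^2 samples has risk at most 3/2 sum_i min (|theta_i|, t)^2 plus
    an exponentially small noise term, which together are at most eps^2. *)
Require Import Defs.
From HB Require Import structures.
From mathcomp Require Import all_boot all_order all_algebra.
From mathcomp Require Import all_classical all_reals all_analysis.
From mathcomp Require Import measurable_realfun ring lra.
Import Order.TTheory GRing.Theory Num.Theory.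
Import numFieldTopology.Exports numFieldNormedType.Exports.
Local Open Scope classical_set_scope.
Local Open Scope ring_scope.
Set Implicit Arguments. Unset Strict Implicit. Unset Printing Implicit Defensive.

(** * Functionals given by integration against a probability measure *)

Section prob_integral.
Context {R : realType}.
Local Open Scope ereal_scope.

(** The expectations in the statement are iterated functionals without a named measure. Agreement
    with some probability integral on nonnegative measurable functions is enough to give the usual
    rules there. *)
Definition prob_integral (d : measure_display) (T : measurableType d)
    (I : (T -> \bar R) -> \bar R) : Prop :=
  exists P : probability T R, forall f : T -> \bar R,
    measurable_fun setT f -> (forall x, 0 <= f x) -> I f = \int[P]_x f x.

Context (d : measure_display) (T : measurableType d).
Variable I : (T -> \bar R) -> \bar R.
Hypothesis PI : prob_integral I.

Lemma prob_integral_comp (d' : measure_display) (T' : measurableType d') (h : T -> T') :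
  measurable_fun setT h -> prob_integral (fun f : T' -> \bar R => I (f \o h)).
Proof.
move=> mh; case: PI => P PE.
pose h' : {mfun T >-> T'} := HB.pack h (isMeasurableFun.Build _ _ _ _ _ mh).
exists (distribution P h') => f mf f0.
rewrite PE; [|exact: measurableT_comp|by move=> x; exact: f0].
by rewrite /distribution ge0_integral_pushforward.
Qed.

Lemma measurable_prob_integral (d' : measure_display) (S : measurableType d')
    (h : S * T -> \bar R) :
  measurable_fun setT h -> (forall p, 0 <= h p) ->
  measurable_fun setT (fun x => I (fun t => h (x, t))).
Proof.
move=> mh h0; case: PI => P PE.
rewrite (_ : (fun x => _) = fubini_F P h).
  exact: measurable_fun_fubini_tonelli_F.
apply/funext => x; rewrite PE//; exact: measurableT_comp.
Qed.

Lemma prob_integral_le (f g : T -> \bar R) :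
  measurable_fun setT f -> measurable_fun setT g -> (forall x, 0 <= f x) ->
  (forall x, f x <= g x) -> I f <= I g.
Proof.
move=> mf mg f0 fg; case: PI => P PE.
rewrite !PE//; last by move=> x; exact: le_trans (fg x).
by apply: ge0_le_integral.
Qed.

Lemma prob_integral_ge0 (f : T -> \bar R) :
  measurable_fun setT f -> (forall x, 0 <= f x) -> 0 <= I f.
Proof.
by move=> mf f0; case: PI => P PE; rewrite PE//; exact: integral_ge0.
Qed.

Lemma prob_integralD (f g : T -> \bar R) :
  measurable_fun setT f -> measurable_fun setT g -> (forall x, 0 <= f x) ->
  (forall x, 0 <= g x) -> I (fun x => f x + g x) = I f + I g.
Proof.
move=> mf mg f0 g0; case: PI => P PE.
rewrite !PE//; first by rewrite ge0_integralD.
- exact: emeasurable_funD.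
- by move=> x; rewrite adde_ge0.
Qed.

Lemma prob_integralZ (c : R) (f : T -> \bar R) : (0 <= c)%R ->
  measurable_fun setT f -> (forall x, 0 <= f x) ->
  I (fun x => c%:E * f x) = c%:E * I f.
Proof.
move=> c0 mf f0; case: PI => P PE.
rewrite !PE//; first by rewrite ge0_integralZl.
- exact: measurable_funeM.
- by move=> x; rewrite mule_ge0.
Qed.

Lemma prob_integral_sum (J : Type) (r : seq J) (f : J -> T -> \bar R) :
  (forall j, measurable_fun setT (f j)) -> (forall j x, 0 <= f j x) ->
  I (fun x => \sum_(j <- r) f j x) = \sum_(j <- r) I (f j).
Proof.
move=> mf f0; case: PI => P PE.
rewrite PE//; last 2 first.
- exact: emeasurable_sum.
- by move=> x; exact: sume_ge0.
by rewrite ge0_integral_sum//; apply: eq_bigr => j _; rewrite PE.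
Qed.

Lemma prob_integral_cst (c : R) : (0 <= c)%R -> I (fun=> c%:E) = c%:E.
Proof.
move=> c0; case: PI => P PE; rewrite PE//.
by rewrite integral_cst// [X in _ * X](@probability_setT _ _ _ P) mule1.
Qed.

End prob_integral.

(** Tonelli; the witness is the product measure. *)
Lemma prob_integral_prod {R : realType} (d1 d2 : measure_display)
    (T1 : measurableType d1) (T2 : measurableType d2)
    (I1 : (T1 -> \bar R) -> \bar R) (I2 : (T2 -> \bar R) -> \bar R) :
  prob_integral I1 -> prob_integral I2 ->
  prob_integral (fun f : T1 * T2 -> \bar R => I1 (fun x => I2 (fun y => f (x, y)))).
Proof.
move=> [P1 P1E] PI2; case: (PI2) => P2 P2E.
exists (P1 \x P2)%E => f mf f0; rewrite fubini_tonelli1// P1E.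
- apply: eq_integral => x _; rewrite P2E//; exact: measurableT_comp.
- exact: (measurable_prob_integral PI2 mf f0).
- move=> x; apply: (prob_integral_ge0 PI2) => //; exact: measurableT_comp.
Qed.

(** * Iterated integrals over tuples *)

Section iint_theory.
Context {R : realType} (d : measure_display) (T : measurableType d).
Variable I : (T -> \bar R) -> \bar R.
Hypothesis PI : prob_integral I.
Local Open Scope ereal_scope.

Lemma measurable_cons_tuple k :
  measurable_fun setT (fun p : T * k.-tuple T => cons_tuple p.1 p.2).
Proof. exact: measurable_cons. Qed.

Lemma measurable_cons_tupler k (x : T) :
  measurable_fun setT (fun t : k.-tuple T => cons_tuple x t).
Proof.
by apply: (@measurable_cons _ _ _ _ (cst x) k id).
Qed.

(** The measure is built by induction: a Dirac mass at the empty tuple, then the image of a product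
    measure under consing. *)
Lemma prob_integral_iint k : prob_integral (@iint R T I k).
Proof.
elim: k => [|k [Pk PkE]] /=.
  exists (\d_([tuple] : 0.-tuple T)) => f mf f0.
  by rewrite integral_dirac// diracT mul1e.
exact: (prob_integral_comp (prob_integral_prod PI (ex_intro _ Pk PkE))
  (@measurable_cons_tuple k)).
Qed.

(** Densities of independent factors multiply; one factor is changed at a time. *)
Lemma iint_density (J : (T -> \bar R) -> \bar R) (w : T -> R) k (g : k.-tuple T -> \bar R) :
  prob_integral J ->
  measurable_fun setT w -> (forall x, (0 <= w x)%R) ->
  (forall f, measurable_fun setT f -> (forall x, 0 <= f x) ->
     J f = I (fun x => f x * (w x)%:E)) ->
  measurable_fun setT g -> (forall x, 0 <= g x) ->
  iint J g = iint I (fun t => g t * (\prod_(j < k) w (tnth t j))%:E).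
Proof.
move=> PJ mw w0 JE; elim: k g => [|k IH] g mg g0 /=.
  by rewrite big_ord0 mule1.
have mgc x : measurable_fun setT (fun t : k.-tuple T => g (cons_tuple x t)).
  by apply: measurableT_comp => //; exact: measurable_cons_tupler.
have mprod : measurable_fun setT (fun t : k.-tuple T => (\prod_(j < k) w (tnth t j))%:E).
  apply/measurable_EFinP; apply: measurable_prod => j _.
  by apply: measurableT_comp => //; exact: measurable_tnth.
transitivity (J (fun x => iint I (fun t => g (cons_tuple x t) * (\prod_(j < k) w (tnth t j))%:E))).
  by congr J; apply/funext => x; exact: IH.
have p0 (t : k.-tuple T) : (0 <= \prod_(j < k) w (tnth t j))%R by exact: prodr_ge0.
have mgp : measurable_fun setT (fun p : T * k.-tuple T =>
    g (cons_tuple p.1 p.2) * (\prod_(j < k) w (tnth p.2 j))%:E).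
  apply: emeasurable_funM.
    by apply: measurableT_comp => //; exact: measurable_cons_tuple.
  by apply: (measurableT_comp mprod).
rewrite JE; first last.
- move=> x; apply: (prob_integral_ge0 (prob_integral_iint k)); last first.
    by move=> t; rewrite mule_ge0// lee_fin.
  exact: emeasurable_funM.
- apply: (measurable_prob_integral (prob_integral_iint k) mgp).
  by move=> p; rewrite mule_ge0// lee_fin.
congr I; apply/funext => x.
rewrite muleC -(prob_integralZ (prob_integral_iint k))//; first last.
- by move=> t; rewrite mule_ge0// lee_fin.
- exact: emeasurable_funM.
congr iint; apply/funext => t; rewrite muleCA; congr (_ * _).
rewrite big_ord_recl EFinM tnth0; congr (_ * _%:E).
by apply: eq_bigr => j _; rewrite tnthS.
Qed.

End iint_theory.

(** * Gaussian integrals on the line *)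

Section gaussian.
Context {R : realType}.
Notation mu := (@lebesgue_measure R).
Local Open Scope ereal_scope.

(** Lebesgue measure is determined by its values on half-open intervals, and these are translation
    invariant. *)
Lemma ge0_integral_shift (a : R) (f : R -> \bar R) :
  measurable_fun setT f -> (forall x, 0 <= f x) ->
  \int[mu]_x f (a + x)%R = \int[mu]_x f x.
Proof.
move=> mf f0.
have ma : measurable_fun setT (fun x : measurableTypeR R => (a + x)%R : measurableTypeR R).
  by apply: measurable_funD.
transitivity (\int[pushforward mu (fun x : measurableTypeR R => (a + x)%R : measurableTypeR R)]_x f x).
  by rewrite ge0_integral_pushforward//.
apply: eq_measure_integral => /= A mA _; apply/esym/lebesgue_measure_unique => //= _ [[c d]] _ <-.
rewrite /pushforward.
rewrite (_ : _ @^-1` _ = `](c - a)%R, (d - a)%R]%classic).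
  rewrite !lebesgue_measure_itv/= !lte_fin ltrD2r; case: ifPn => // _.
  by rewrite -!EFinD; congr EFin; ring.
by apply/seteqP; split => x /=; rewrite !in_itv/= ltrBlDl lerBrDl.
Qed.

(** The Radon-Nikodym derivative of the normal law and [normal_pdf] have equal integrals over every
    measurable set, so they agree almost everywhere. *)
Lemma ge0_integral_normal_prob (m s : R) (f : R -> \bar R) :
  measurable_fun setT f -> (forall x, 0 <= f x) ->
  \int[normal_prob m s]_x f x = \int[mu]_x (f x * (normal_pdf m s x)%:E).
Proof.
move=> mf f0.
have dom := normal_prob_dominates m s.
rewrite -(Radon_Nikodym_SigmaFinite.change_of_variables dom)//.
have mh : measurable_fun setT (Radon_Nikodym_SigmaFinite.f (normal_prob m s) mu).
  exact: (measurable_int _ (Radon_Nikodym_SigmaFinite.f_integrable dom)).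
have mp : measurable_fun setT (fun x => (normal_pdf m s x)%:E).
  by apply/measurable_EFinP; exact: measurable_normal_pdf.
apply: ae_eq_integral => //; [exact: emeasurable_funM..|].
apply: ae_eqe_mul2l; apply: integral_ae_eq => //.
  exact: Radon_Nikodym_SigmaFinite.f_integrable.
by move=> E _ mE; rewrite -Radon_Nikodym_SigmaFinite.f_integral.
Qed.

Lemma prob_integral_std_normal : prob_integral (@std_normal_int R).
Proof.
(* The normal law lives on [measurableTypeR R]; the identity map, being measurable, transports it to
   [R]. *)
pose P : probability (measurableTypeR R) R := normal_prob 0%R 1%R.
have PI : prob_integral (fun f : measurableTypeR R -> \bar R => std_normal_int f).
  by exists P.
have mid : measurable_fun setT (idfun : measurableTypeR R -> R).
  by move=> _ A mA; rewrite setTI.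
exact: (prob_integral_comp PI mid). Qed.

(** Cameron-Martin formula on the line: the weight is the ratio of the densities of N(a, 1) and N(0,
    1). *)
Lemma std_normal_int_shift (a : R) (f : R -> \bar R) :
  measurable_fun setT f -> (forall x, 0 <= f x) ->
  std_normal_int (fun x => f (a + x)%R) =
  std_normal_int (fun x => f x * (expR (a * x - a ^+ 2 / 2))%:E).
Proof.
move=> mf f0; rewrite /std_normal_int.
have mw : measurable_fun setT (fun x : R => (expR (a * x - a ^+ 2 / 2))%:E).
  apply/measurable_EFinP; apply: measurableT_comp => //.
  by apply: measurable_funB => //; apply: measurable_funM.
have mp : measurable_fun setT (fun x => (normal_pdf 0 1 x : R)%:E).
  by apply/measurable_EFinP; exact: measurable_normal_pdf.
rewrite !ge0_integral_normal_prob//; first last.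
- by apply: measurableT_comp => //; exact: measurable_funD.
- by move=> x; rewrite mule_ge0// lee_fin expR_ge0.
- exact: emeasurable_funM.
rewrite -[RHS](@ge0_integral_shift a); first last.
- by move=> x; rewrite !mule_ge0// lee_fin ?expR_ge0 ?normal_pdf_ge0.
- by apply: emeasurable_funM => //; exact: emeasurable_funM.
apply: eq_integral => x _; rewrite -muleA -EFinM; congr (_ * _%:E).
rewrite !normal_pdfE// mulrCA -expRD; congr (_ * expR _)%R.
by field.
Qed.

End gaussian.

(** * Gaussian vectors, samples and likelihood ratios *)

Section gaussian_vector.
Context {R : realType}.
Local Open Scope ereal_scope.
Notation std := (@std_normal_int R).

Lemma measurable_tuple_shift D (a : 'I_D -> R) :
  measurable_fun setT (fun z : D.-tuple R => [tuple (a i + tnth z i)%R | i < D]).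
Proof.
apply/measurable_fun_tnthP => i; rewrite /comp.
under eq_fun do rewrite tnth_mktuple.
by apply: measurable_funD => //; exact: measurable_tnth.
Qed.

Lemma measurable_expR_lin D (a b : 'I_D -> R) :
  measurable_fun setT (fun z : D.-tuple R => (expR (\sum_i (a i * tnth z i - b i)))%:E).
Proof.
apply/measurable_EFinP; apply: measurableT_comp => //.
apply: measurable_sum => i; apply: measurable_funB => //.
by apply: measurable_funM => //; exact: measurable_tnth.
Qed.

(** Cameron-Martin formula in dimension D. The shift varies with the coordinate, whereas
    [iint_density] has one weight for all factors, so the induction is redone. *)
Lemma iint_std_shift D (a : 'I_D -> R) (h : D.-tuple R -> \bar R) :
  measurable_fun setT h -> (forall z, 0 <= h z) ->
  iint std (fun z => h [tuple (a i + tnth z i)%R | i < D]) =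
  iint std (fun z => h z * (expR (\sum_i (a i * tnth z i - a i ^+ 2 / 2)))%:E).
Proof.
elim: D a h => [|D IH] a h mh h0 /=.
  by rewrite big_ord0 expR0 mule1; congr h; exact: tuple0.
have PD := prob_integral_iint (@prob_integral_std_normal R) D.
pose w (t : D.-tuple R) : \bar R :=
  (expR (\sum_i (a (lift ord0 i) * tnth t i - a (lift ord0 i) ^+ 2 / 2)))%:E.
have mw : measurable_fun setT w by exact: measurable_expR_lin.
have w0 t : 0 <= w t by rewrite lee_fin expR_ge0.
have mhc y : measurable_fun setT (fun t : D.-tuple R => h (cons_tuple y t)).
  by apply: measurableT_comp => //; exact: measurable_cons_tupler.
have mhw y : measurable_fun setT (fun t : D.-tuple R => h (cons_tuple y t) * w t).
  exact: emeasurable_funM.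
pose F y := iint std (fun t : D.-tuple R => h (cons_tuple y t) * w t).
have F0 y : 0 <= F y by rewrite /F; apply: (prob_integral_ge0 PD) => // t; rewrite mule_ge0.
have mF : measurable_fun setT F.
  apply: (@measurable_prob_integral _ _ _ _ PD _ R
    (fun p => h (cons_tuple p.1 p.2) * w p.2)); last by move=> p; rewrite mule_ge0.
  apply: emeasurable_funM; last exact: measurableT_comp.
  by apply: measurableT_comp => //; exact: measurable_cons_tuple.
transitivity (std (fun x => F (a ord0 + x)%R)).
  congr std; apply/funext => x; rewrite /F.
  rewrite -(IH (fun i => a (lift ord0 i)) (fun t => h (cons_tuple (a ord0 + x)%R t)))//.
  congr iint; apply/funext => t; congr h; apply: eq_from_tnth => i.
  rewrite tnth_mktuple; case: (unliftP ord0 i) => [j ->|->].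
    by rewrite !tnthS tnth_mktuple.
  by rewrite !tnth0.
rewrite std_normal_int_shift//; congr std; apply/funext => x.
rewrite muleC -(prob_integralZ PD) ?expR_ge0//; last by move=> t; rewrite mule_ge0.
congr iint; apply/funext => t; rewrite muleCA; congr (_ * _).
rewrite -EFinM -expRD big_ord_recl tnth0; congr (expR (_ + _))%:E.
by apply: eq_bigr => i _; rewrite tnthS.
Qed.

Lemma gauss_vec_intE D (theta : 'rV[R]_D) (h : D.-tuple R -> \bar R) :
  measurable_fun setT h -> (forall z, 0 <= h z) ->
  gauss_vec_int theta h = iint std (fun z =>
    h z * (expR (\sum_i (theta ord0 i * tnth z i - theta ord0 i ^+ 2 / 2)))%:E).
Proof. exact: iint_std_shift. Qed.

Lemma gauss_vec_int0 D : gauss_vec_int (0 : 'rV[R]_D) = @iint R R std D.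
Proof.
apply/funext => h; congr iint; apply/funext => z; congr h.
by apply: eq_from_tnth => i; rewrite tnth_mktuple mxE add0r.
Qed.

Lemma prob_integral_gauss_vec D (theta : 'rV[R]_D) : prob_integral (gauss_vec_int theta).
Proof.
exact: (prob_integral_comp (prob_integral_iint prob_integral_std_normal D)
  (measurable_tuple_shift (theta ord0))).
Qed.

Lemma prob_integral_gauss_sample D (theta : 'rV[R]_D) n :
  prob_integral (@gauss_sample_exp R D theta n).
Proof. exact: (prob_integral_iint (prob_integral_gauss_vec theta)). Qed.

Definition coord_sum D n (X : n.-tuple (D.-tuple R)) (i : 'I_D) : R :=
  (\sum_(j < n) tnth (tnth X j) i)%R.

(** The density of n samples from N(theta, I) relative to n samples from N(0, I); it depends on the
    sample only through the coordinate sums. *)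
Definition gauss_lr D n (theta : 'rV[R]_D) (X : n.-tuple (D.-tuple R)) : R :=
  expR (\sum_i theta ord0 i * coord_sum X i - n%:R / 2 * \sum_i theta ord0 i ^+ 2)%R.

Lemma measurable_coord_sum D n (i : 'I_D) :
  measurable_fun setT (fun X : n.-tuple (D.-tuple R) => coord_sum X i).
Proof.
apply: measurable_sum => j.
exact: (measurableT_comp (measurable_tnth i) (measurable_tnth j)).
Qed.

Lemma measurable_gauss_lr D n (theta : 'rV[R]_D) :
  measurable_fun setT (@gauss_lr D n theta).
Proof.
apply: measurableT_comp => //; apply: measurable_funB => //.
by apply: measurable_sum => i; apply: measurable_funM => //; exact: measurable_coord_sum.
Qed.

Lemma gauss_lr_ge0 D n (theta : 'rV[R]_D) (X : n.-tuple (D.-tuple R)) :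
  (0 <= gauss_lr theta X)%R.
Proof. exact: expR_ge0. Qed.

Lemma gauss_sample_exp_lr D n (theta : 'rV[R]_D) (g : n.-tuple (D.-tuple R) -> \bar R) :
  measurable_fun setT g -> (forall X, 0 <= g X) ->
  gauss_sample_exp theta g = gauss_sample_exp 0 (fun X => g X * (gauss_lr theta X)%:E).
Proof.
move=> mg g0; rewrite /gauss_sample_exp.
pose w (z : D.-tuple R) := expR (\sum_i (theta ord0 i * tnth z i - theta ord0 i ^+ 2 / 2)).
rewrite (iint_density (prob_integral_gauss_vec 0) (w := w)
  (prob_integral_gauss_vec theta))//; first last.
- by move=> f mf f0; rewrite gauss_vec_int0 gauss_vec_intE.
- by move=> x; exact: expR_ge0.
- by apply/measurable_EFinP; exact: measurable_expR_lin.
congr iint; apply/funext => X; congr (_ * _%:E).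
rewrite /w /gauss_lr -expR_sum; congr expR.
rewrite exchange_big /= mulr_sumr -sumrB; apply: eq_bigr => i _.
rewrite sumrB -mulr_sumr; congr (_ - _)%R.
by rewrite sumr_const card_ord -mulr_natl; field.
Qed.

Lemma gauss_sample_exp_gauss_lr D n (theta : 'rV[R]_D) :
  gauss_sample_exp 0 (fun X : n.-tuple (D.-tuple R) => (gauss_lr theta X)%:E) = 1.
Proof.
have <- : gauss_sample_exp theta (fun _ : n.-tuple (D.-tuple R) => 1%:E) = 1.
  exact: (prob_integral_cst (prob_integral_gauss_sample theta n)).
rewrite [RHS]gauss_sample_exp_lr//; congr gauss_sample_exp; apply/funext => X.
by rewrite mul1e.
Qed.

End gaussian_vector.

(** * Second moment bound for tests *)

Section testing.
Context {R : realType}.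

(** This is cosh x <= exp (2 x^2). For |x| <= 1/2 the two exponentials are at most 1 / (1 - x) and 1
    / (1 + x); otherwise |x| <= 2 x^2. *)
Lemma expRD_expRN_le (x : R) : expR x + expR (- x) <= 2 * expR (2 * x ^+ 2).
Proof.
have [hx|hx] := leP `|x| (1 / 2).
  have hx1 : x <= 1 / 2 by exact: le_trans (ler_norm x) hx.
  have hx2 : - x <= 1 / 2 by apply: le_trans hx; rewrite -normrN ler_norm.
  have x2 : x ^+ 2 <= 1 / 4 by nra.
  have e1 : expR x <= (1 - x)^-1.
    by rewrite -[x in expR x]opprK expRN lef_pV2 ?posrE ?expR_gt0 ?expR_ge1Dx//; lra.
  have e2 : expR (- x) <= (1 + x)^-1.
    by rewrite expRN lef_pV2 ?posrE ?expR_gt0 ?expR_ge1Dx//; lra.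
  apply: (le_trans (lerD e1 e2)).
  have -> : (1 - x)^-1 + (1 + x)^-1 = 2 / (1 - x ^+ 2).
    by field; apply/and3P; split; apply/eqP; nra.
  apply: (@le_trans _ _ (2 * (1 + 2 * x ^+ 2))); last first.
    by rewrite ler_pM2l// expR_ge1Dx.
  rewrite ler_pdivrMr; last lra.
  have := sqr_ge0 x; nra.
have h : `|x| <= 2 * x ^+ 2 by rewrite -real_normK ?num_real//; nra.
have e1 : expR x <= expR (2 * x ^+ 2) by rewrite ler_expR (le_trans (ler_norm x)).
have e2 : expR (- x) <= expR (2 * x ^+ 2).
  by rewrite ler_expR (le_trans _ h)// -normrN ler_norm.
lra.
Qed.

(** Expanding the product picks one sign per coordinate. *)
Lemma sum_sign_expR D (a : 'I_D -> R) :
  \sum_(s : {ffun 'I_D -> bool}) expR (\sum_i (-1) ^+ s i * a i) =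
  \prod_i (expR (a i) + expR (- a i)).
Proof.
under [RHS]eq_bigr => i _.
  rewrite [X in X + _](_ : _ = expR ((-1) ^+ false * a i)); last by rewrite expr0 mul1r.
  rewrite [X in _ + X](_ : _ = expR ((-1) ^+ true * a i)); last by rewrite expr1 mulN1r.
  rewrite addrC -(big_bool _ (fun b : bool => expR ((-1) ^+ b * a i))).
  over.
rewrite /= bigA_distr_bigA /=; apply: eq_bigr => s _.
by rewrite expR_sum.
Qed.

Definition flip_signs D (s : {ffun 'I_D -> bool}) (theta : 'rV[R]_D) : 'rV[R]_D :=
  \row_i ((-1) ^+ s i * theta ord0 i).

Lemma norm2_flip_signs D (s : {ffun 'I_D -> bool}) (theta : 'rV[R]_D) :
  norm2 (flip_signs s theta) = norm2 theta.
Proof.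
congr Num.sqrt; apply: eq_bigr => i _.
by rewrite mxE exprMn -exprM mulnC exprM sqrrN expr1n expr1n mul1r.
Qed.

Lemma flip_signs_in D (Gamma : set 'rV[R]_D) (s : {ffun 'I_D -> bool}) (theta : 'rV[R]_D) :
  orthosymmetric Gamma -> Gamma theta -> Gamma (flip_signs s theta).
Proof.
move=> oG Gt; apply: oG => // i.
by case: (s i); [right; rewrite expr1|left; rewrite expr0].
Qed.

(** The exponents are linear in the sample, so a product of two likelihood ratios is again one up to
    a constant. Its null expectation is then known, since a likelihood ratio integrates to one. *)
Lemma gauss_lrM D n (theta eta : 'rV[R]_D) (X : n.-tuple (D.-tuple R)) :
  gauss_lr theta X * gauss_lr eta X =
  expR (n%:R * \sum_i theta ord0 i * eta ord0 i) * gauss_lr (theta + eta) X.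
Proof.
rewrite /gauss_lr -!expRD; congr expR.
rewrite !mulr_sumr -!sumrB -!big_split /=; apply: eq_bigr => i _.
by rewrite !mxE; field.
Qed.

Lemma gauss_lr_corr D n (theta eta : 'rV[R]_D) :
  gauss_sample_exp 0 (fun X : n.-tuple (D.-tuple R) =>
    (gauss_lr theta X * gauss_lr eta X)%:E) =
  (expR (n%:R * \sum_i theta ord0 i * eta ord0 i))%:E.
Proof.
under eq_fun do rewrite gauss_lrM EFinM.
rewrite (prob_integralZ (prob_integral_gauss_sample 0 n)) ?expR_ge0//.
- by rewrite gauss_sample_exp_gauss_lr mule1.
- by apply/measurable_EFinP; exact: measurable_gauss_lr.
- by move=> X; rewrite lee_fin gauss_lr_ge0.
Qed.

Lemma measurable_fun_test (d : measure_display) (T : measurableType d) (psi : T -> bool) :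
  measurable (psi @^-1` [set true]) ->
  measurable_fun setT (fun x => ((psi x)%:R : R)%:E).
Proof.
move=> mp; apply/measurable_EFinP.
rewrite (_ : (fun x => _) = \1_(psi @^-1` [set true])); first exact: measurable_indic.
apply/funext => x; rewrite indicE; congr (nat_of_bool _)%:R.
by apply/idP/idP => [h|]; [rewrite inE|rewrite inE].
Qed.

Lemma gof_power D n (theta : 'rV[R]_D) (psi : n.-tuple (D.-tuple R) -> bool) :
  measurable (psi @^-1` [set true]) ->
  (gauss_sample_exp theta (fun X => ((~~ psi X)%:R : R)%:E) <= (1 / 4 : R)%:E)%E ->
  ((3 / 4)%:E <= gauss_sample_exp 0 (fun X => ((psi X)%:R * gauss_lr theta X)%:E))%E.
Proof.
move=> mp h.
have mpsi := measurable_fun_test mp.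
have mnpsi : measurable_fun setT (fun X => ((~~ psi X)%:R : R)%:E).
  apply: measurable_fun_test.
  rewrite (_ : _ @^-1` _ = ~` (psi @^-1` [set true])); first exact: measurableC.
  by apply/seteqP; split => X /=; case: (psi X).
have E := prob_integralD (prob_integral_gauss_sample theta n) mpsi mnpsi
  (fun X => ler0n _ _) (fun X => ler0n _ _).
rewrite (_ : (fun X => _) = (fun X => ((psi X)%:R : R)%:E * (gauss_lr theta X)%:E)%E); last first.
  by apply/funext => X; rewrite EFinM.
rewrite -gauss_sample_exp_lr//.
(* Adding 1/4, an upper bound for the error at [theta], reduces the claim to the fact that the two
   indicators sum to one. *)
rewrite -(@leeD2rE _ (1 / 4 : R)%:E)//.
apply: (@le_trans _ _ 1%E); first by rewrite -EFinD lee_fin; lra.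
apply: le_trans (leeD2l _ h).
rewrite -E.
rewrite (_ : (fun X => _) = fun=> 1%:E).
  by rewrite (prob_integral_cst (prob_integral_gauss_sample theta n)).
by apply/funext => X; case: (psi X); rewrite -EFinD ?addr0 ?add0r.
Qed.

(** With M = 2^D, [Q] is M^2 times the null second moment of the likelihood ratio of the uniform
    mixture over sign flips. Power at least 3/4 against error at most 1/4 forces Q >= 9/4 M^2, and
    factorisation over coordinates bounds [Q] from above. *)
Lemma gof_fourth_moment D (Gamma : set 'rV[R]_D) (delta : R) n (theta : 'rV[R]_D) :
  orthosymmetric Gamma -> gof_ok Gamma delta n -> Gamma theta -> delta <= norm2 theta ->
  9 / 4 <= expR (2 * n%:R ^+ 2 * \sum_i theta ord0 i ^+ 4).
Proof.
move=> oG [psi [mp [h0 h1]]] Gt dt.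
pose S := {ffun 'I_D -> bool}.
pose M : R := 2 ^+ D.
have M0 : 0 < M by exact: exprn_gt0.
have cardS : #|{: S}|%:R = M by rewrite card_ffun card_bool card_ord natrX.
have PI := prob_integral_gauss_sample (0 : 'rV[R]_D) n.
pose lr s := @gauss_lr R D n (flip_signs s theta).
have lr0 s X : 0 <= lr s X by exact: gauss_lr_ge0.
have mlr s : measurable_fun setT (lr s) by exact: measurable_gauss_lr.
have mpsi := measurable_fun_test mp.
pose A := gauss_sample_exp (0 : 'rV[R]_D) (fun X => (\sum_(s : S) (psi X)%:R * lr s X)%:E).
pose Q := \sum_(s : S) \sum_(s' : S)
  expR (n%:R * \sum_i flip_signs s theta ord0 i * flip_signs s' theta ord0 i).
have lowA : ((3 / 4 * M)%:E <= A)%E.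
  rewrite /A; under eq_fun do rewrite -sumEFin.
  rewrite (prob_integral_sum PI); first last.
  - by move=> s X; rewrite lee_fin mulr_ge0.
  - move=> s; apply/measurable_EFinP; apply: measurable_funM => //.
    exact/measurable_EFinP.
  rewrite -cardS mulr_natr -sumr_const -sumEFin; apply: lee_sum => s _.
  apply: gof_power => //; apply: h1; first exact: flip_signs_in.
  by rewrite norm2_flip_signs.
have mpsiM : measurable_fun setT (fun X => ((3 / 2 * M)%:E * ((psi X)%:R)%:E)%E).
  exact: measurable_funeM.
have m2 : measurable_fun setT (fun X => (\sum_(s : S) \sum_(s' : S) (lr s X * lr s' X)%:E)%E).
  apply: emeasurable_sum => s; apply: emeasurable_sum => s'.
  by apply/measurable_EFinP; exact: measurable_funM.
have p2 X : (0 <= \sum_(s : S) \sum_(s' : S) (lr s X * lr s' X)%:E)%E.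
  by apply: sume_ge0 => s _; apply: sume_ge0 => s' _; rewrite lee_fin mulr_ge0.
have cM : 0 <= (6 * M)^-1 by rewrite invr_ge0 mulr_ge0// ltW.
(* Linearised Cauchy-Schwarz, psi L <= 3/2 M psi + L^2 / (6 M), with L the sum of the likelihood
   ratios. The constants are fitted to L = 3 M on a rejection region of null probability 1/4, where
   the average power is 3/4. *)
have upA : (A <= (3 / 8 * M + (6 * M)^-1 * Q)%:E)%E.
  apply: (@le_trans _ _ (gauss_sample_exp (0 : 'rV[R]_D) (fun X =>
    (3 / 2 * M)%:E * ((psi X)%:R)%:E +
    ((6 * M)^-1)%:E * \sum_(s : S) \sum_(s' : S) (lr s X * lr s' X)%:E)%E)).
    apply: (prob_integral_le PI).
    - apply/measurable_EFinP; apply: measurable_sum => s; apply: measurable_funM => //.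
      exact/measurable_EFinP.
    - by apply: emeasurable_funD => //; exact: measurable_funeM.
    - by move=> X; rewrite lee_fin sumr_ge0// => s _; rewrite mulr_ge0.
    - move=> X.
      rewrite (_ : (\sum_(s : S) \sum_(s' : S) _)%E = ((\sum_(s : S) lr s X) ^+ 2)%:E); last first.
        rewrite expr2 mulr_suml -sumEFin; apply: eq_bigr => s _.
        by rewrite mulr_sumr -sumEFin.
      rewrite -!EFinM -EFinD lee_fin -mulr_sumr.
      set L := \sum_(s : S) _.
      have L0 : 0 <= (6 * M)^-1 * L ^+ 2 by rewrite mulr_ge0// sqr_ge0.
      case: (psi X); last by rewrite mul0r mulr0 add0r.
      (* AM-GM around the value L = 3 M *)
      rewrite mul1r mulr1 -subr_ge0.
      rewrite (_ : _ - L = (6 * M)^-1 * (L - 3 * M) ^+ 2).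
        by rewrite mulr_ge0// sqr_ge0.
      by field; rewrite gt_eqF.
  rewrite (prob_integralD PI)//; first last.
  - by move=> X; rewrite mule_ge0.
  - by move=> X; rewrite -EFinM lee_fin !mulr_ge0// ltW.
  - exact: measurable_funeM.
  rewrite !(prob_integralZ PI)//; last by rewrite !mulr_ge0// ltW.
  rewrite EFinD; apply: leeD.
    apply: (@le_trans _ _ ((3 / 2 * M)%:E * (1 / 4)%:E)%E).
      by apply: lee_wpmul2l => //; rewrite lee_fin !mulr_ge0// ltW.
    by rewrite -EFinM lee_fin; lra.
  rewrite EFinM; apply: lee_wpmul2l => //.
  rewrite (prob_integral_sum PI); first last.
  - by move=> s X; apply: sume_ge0 => s' _; rewrite lee_fin mulr_ge0.
  - move=> s; apply: emeasurable_sum => s'.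
    by apply/measurable_EFinP; exact: measurable_funM.
  rewrite /Q -sumEFin; apply: lee_sum => s _.
  rewrite (prob_integral_sum PI); first last.
  - by move=> s' X; rewrite lee_fin mulr_ge0.
  - by move=> s'; apply/measurable_EFinP; exact: measurable_funM.
  by rewrite -sumEFin; apply: lee_sum => s' _; rewrite gauss_lr_corr.
(* For fixed s, summing over s' gives the product over i of 2 cosh (n theta_i^2), whatever the signs
   s. *)
have QE : Q <= M * (M * expR (2 * n%:R ^+ 2 * \sum_i theta ord0 i ^+ 4)).
  rewrite -cardS mulr_natl -sumr_const; apply: ler_sum => s _.
  under eq_bigr => s' _.
    rewrite mulr_sumr.
    rewrite (eq_bigr (fun i => (-1) ^+ (s' i : bool) *
      (n%:R * ((-1) ^+ (s i : bool) * theta ord0 i ^+ 2)))); last first.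
      by move=> i _; rewrite !mxE; ring.
    over.
  rewrite sum_sign_expR cardS /M mulr_sumr expR_sum.
  rewrite (_ : 2 ^+ D = \prod_(i < D) (2 : R)); last by rewrite prodr_const card_ord.
  rewrite -big_split /=.
  apply: ler_prod => i _; rewrite addr_ge0 ?expR_ge0//=.
  apply: le_trans (expRD_expRN_le _) _; rewrite ler_pM2l// ler_expR.
  rewrite le_eqVlt; apply/orP; left; apply/eqP.
  by case: (s i); rewrite ?expr0 ?expr1; ring.
have := le_trans lowA upA; rewrite lee_fin => h.
rewrite -(ler_pM2l M0).
have h2 : 3 / 8 * M <= (6 * M)^-1 * Q by lra.
have := le_trans h2 (ler_wpM2l cM QE).
rewrite (_ : (6 * M)^-1 * (M * _) = (M * expR (2 * n%:R ^+ 2 * \sum_i theta ord0 i ^+ 4)) / 6).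
  by move=> h3; lra.
by field; rewrite gt_eqF.
Qed.

End testing.

(** * Solidity of orthosymmetric convex sets *)

Section solid.
Context {R : realType}.

(** Coordinates of [theta] are replaced by those of [eta] one at a time. Any number between -t and t
    is a convex combination of the two, and orthosymmetry supplies the point reflected in that
    coordinate. *)
Lemma orthosymmetric_convex_solid D (Gamma : set 'rV[R]_D) (theta eta : 'rV[R]_D) :
  orthosymmetric Gamma -> convex_set (Gamma : set (convex_lmodType 'rV[R]_D)) ->
  Gamma theta -> (forall i, `|eta ord0 i| <= `|theta ord0 i|) -> Gamma eta.
Proof.
move=> oG cG Gt le.
suff H k : Gamma (\row_i if (i < k)%N then eta ord0 i else theta ord0 i).
  by have := H D; congr Gamma; apply/rowP => i; rewrite mxE ltn_ord.
elim: k => [|k IH].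
  by rewrite (_ : \row_i _ = theta)//; apply/rowP => i; rewrite mxE.
set v := \row_i _ in IH.
pose s (i : 'I_D) : R := if i == k :> nat then -1 else 1.
have s1 i : s i = 1 \/ s i = -1 by rewrite /s; case: ifP; [right|left].
have Gv' := oG _ IH _ s1.
have [kD|Dk] := ltnP k D; last first.
  rewrite (_ : \row_i _ = v)//; apply/rowP => i; rewrite !mxE.
  by rewrite (leq_trans (ltn_ord i) Dk) (leq_trans (ltn_ord i) (leqW Dk)).
pose ik := Ordinal kD.
(* If the coordinate of [theta] vanishes, so does that of [eta], and division by zero gives a =
   0. *)
pose a := eta ord0 ik / theta ord0 ik.
have ha : eta ord0 ik = a * theta ord0 ik.
  have [t0|t0] := eqVneq (theta ord0 ik) 0; last by rewrite /a divfK.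
  by have := le ik; rewrite t0 normr0 normr_le0 => /eqP ->; rewrite mulr0.
have a1 : `|a| <= 1.
  have [t0|t0] := eqVneq (theta ord0 ik) 0; first by rewrite /a t0 invr0 mulr0 normr0.
  by rewrite /a normrM normfV ler_pdivrMr ?normr_gt0// mul1r.
(* The weight p = (1 + a) / 2 solves p t - (1 - p) t = a t. *)
have p0 : 0 <= (1 + a) / 2 by move: a1; rewrite ler_norml => /andP[]; lra.
have p1 : (1 + a) / 2 <= 1 by move: a1; rewrite ler_norml => /andP[]; lra.
have := cG _ _ (Itv01 p0 p1) (mem_set IH) (mem_set Gv').
move=> /set_mem; congr Gamma; apply/rowP => i.
rewrite /conv /= !mxE /s /unstable.onem [(i < k.+1)%N]ltnS [(i <= k)%N]leq_eqVlt.
have [eik|nik] := eqVneq (i : nat) k; last by case: ifP => _; field.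
have -> : i = ik by exact: val_inj.
by rewrite ltnn /= ha; field.
Qed.

End solid.

(** * Soft thresholding of one coordinate *)

Section soft_threshold.
Context {R : realType}.

(** For l >= 0 this is the usual sign (x) max (0, |x| - l), written as x minus its projection onto
    [-l, l]. *)
Definition soft (l x : R) : R := x - Num.max (- l) (Num.min l x).

Lemma measurable_soft (d : measure_display) (T : measurableType d) l (f : T -> R) :
  measurable_fun setT f -> measurable_fun setT (fun x => soft l (f x)).
Proof.
move=> mf; apply: measurable_funB => //; apply: measurable_maxr => //.
exact: measurable_minr.
Qed.

(** The error is N - c, with c the projection of theta + N onto [-l, l]; |c| <= l gives the bound
    with 2 l. For the bound with |theta|: the error is -theta if nothing is clipped, and otherwise
    lies between -theta and, up to sign, the noise excess (|N| - l)_+. *)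
Lemma soft_error_abs (l theta N : R) : 0 <= l ->
  `|soft l (theta + N) - theta| <=
  Num.min `|theta| (2 * l) + Num.max 0 (`|N| - l).
Proof.
move=> l0; rewrite /soft.
set c := Num.max _ _; set m := Num.min `|theta| _; set e := Num.max 0 _.
have e0 : 0 <= e by rewrite le_max lexx.
have eN : `|N| - l <= e by rewrite le_max lexx orbT.
have [c1 c2] : c <= l /\ - l <= c.
  by rewrite le_max lexx ge_max ge_min lexx; split => //; rewrite andbT; lra.
have [N1 N2] : - `|N| <= N /\ N <= `|N| by rewrite ler_norm lerNl -normrN ler_norm.
have cE : c = theta + N \/ c = l /\ l <= theta + N \/ c = - l /\ theta + N <= - l.
  rewrite /c; have [h1|h1] := leP l (theta + N).
    have -> : Num.max (- l) l = l by apply/max_idPr; lra.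
    by right; left.
  have [h2|h2] := leP (- l) (theta + N); first by left.
  by right; right; split => //; exact: ltW.
have [m1|m1] : m = `|theta| \/ m = 2 * l by rewrite /m; case: leP; tauto.
- have [t1 t2] : - `|theta| <= theta /\ theta <= `|theta|.
    by rewrite ler_norm lerNl -normrN ler_norm.
  by rewrite m1 ler_norml; apply/andP; case: cE => [->|[[->]|[->]]]; split; lra.
- rewrite m1 ler_norml; apply/andP; split; lra.
Qed.

(** From exp y >= 1 + y^2 / 2 at y = k x. The positive part is traded for an exponential, whose
    Gaussian expectation is explicit. *)
Lemma max0_sqr_le (k x : R) : 0 < k -> (Num.max 0 x) ^+ 2 <= 2 / k ^+ 2 * expR (k * x).
Proof.
move=> k0; case: (leP 0 x) => x0; last first.
  by rewrite expr0n /= mulr_ge0 ?expR_ge0// divr_ge0// sqr_ge0.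
have := expR_ge1Dxn 1 (mulr_ge0 (ltW k0) x0).
rewrite (_ : 2`!%:R = 2)// => h.
rewrite mulrAC ler_pdivlMr ?exprn_gt0// -exprMn mulrC; lra.
Qed.

Lemma soft_error (l k theta N : R) : 0 <= l -> 0 < k ->
  (soft l (theta + N) - theta) ^+ 2 <=
  3 / 2 * (Num.min `|theta| (2 * l)) ^+ 2 +
  6 / k ^+ 2 * (expR (k * (N - l)) + expR (k * (- N - l))).
Proof.
move=> l0 k0; have := soft_error_abs theta N l0.
set m := Num.min _ _; set e := Num.max 0 _ => h.
have e2 : e ^+ 2 <= 2 / k ^+ 2 * (expR (k * (N - l)) + expR (k * (- N - l))).
  apply: le_trans (max0_sqr_le _ k0) _.
  rewrite ler_pM2l ?divr_gt0 ?exprn_gt0//.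
  have := expR_ge0 (k * (N - l)); have := expR_ge0 (k * (- N - l)).
  by case: (ger0P N) => _; lra.
have h2 : (soft l (theta + N) - theta) ^+ 2 <= (m + e) ^+ 2.
  by rewrite -real_normK ?num_real// lerXn2r ?nnegrE// (le_trans _ h).
apply: (le_trans h2).
(* This gives (m + e)^2 <= 3/2 m^2 + 3 e^2. As the m^2 will sum to at most eps^2 / 2, the factor 3/2
   leaves eps^2 / 4 for the noise. *)
have := sqr_ge0 (m - 2 * e) => h3; nra.
Qed.

End soft_threshold.

(** * Risk of the soft-thresholded sample mean *)

Section estimation.
Context {R : realType}.

(** The exponential of c times a coordinate sum is a multiple of the likelihood ratio of c e_i, so
    [gauss_lr_corr] evaluates the expectation. *)
Lemma gauss_sample_exp_mgf D n (theta : 'rV[R]_D) (c : R) (i : 'I_D) :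
  gauss_sample_exp theta (fun X : n.-tuple (D.-tuple R) => (expR (c * coord_sum X i))%:E) =
  (expR (n%:R * (c * theta ord0 i + c ^+ 2 / 2)))%:E.
Proof.
have mS : measurable_fun setT
    (fun X : n.-tuple (D.-tuple R) => (expR (c * coord_sum X i))%:E).
  apply/measurable_EFinP; apply: measurableT_comp => //.
  by apply: measurable_funM => //; exact: measurable_coord_sum.
rewrite gauss_sample_exp_lr//.
pose e : 'rV[R]_D := c *: delta_mx ord0 i.
have eE j : e ord0 j = if j == i then c else 0.
  by rewrite !mxE eqxx /=; case: eqP; rewrite ?mulr1 ?mulr0.
have sumE (F : 'I_D -> R) : \sum_j e ord0 j * F j = c * F i.
  rewrite (bigD1 i)//= eE eqxx big1 ?addr0// => j /negPf ji.
  by rewrite eE ji mul0r.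
have -> : (fun X : n.-tuple (D.-tuple R) => ((expR (c * coord_sum X i))%:E * (gauss_lr theta X)%:E)%E) =
    (fun X => (expR (n%:R / 2 * c ^+ 2))%:E * (gauss_lr e X * gauss_lr theta X)%:E)%E.
  apply/funext => X; rewrite -!EFinM mulrA; congr (_ * _)%:E.
  rewrite /gauss_lr -expRD; congr expR; rewrite sumE.
  under eq_bigr do rewrite expr2.
  by rewrite sumE eE eqxx; ring.
rewrite (prob_integralZ (prob_integral_gauss_sample 0 n)) ?expR_ge0//; first last.
- by move=> X; rewrite lee_fin mulr_ge0// gauss_lr_ge0.
- by apply/measurable_EFinP; apply: measurable_funM; exact: measurable_gauss_lr.
rewrite gauss_lr_corr -EFinM -expRD; congr (expR _)%:E; rewrite sumE.
by ring.
Qed.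

Definition soft_mean D m (l : R) (X : m.-tuple (D.-tuple R)) : D.-tuple R :=
  [tuple soft l (coord_sum X i / m%:R) | i < D].

Lemma measurable_soft_mean D m l : measurable_fun setT (@soft_mean D m l).
Proof.
apply/measurable_fun_tnthP => i; rewrite /comp.
under eq_fun do rewrite tnth_mktuple.
apply: measurable_soft; apply: measurable_funM => //; exact: measurable_coord_sum.
Qed.

(** Sum of [soft_error] over coordinates, N being the error of the sample mean. Both exponential
    terms have expectation exp (k^2 / (2 m) - k l); k stays free for now. *)
Lemma soft_mean_risk D m (l k : R) (theta : 'rV[R]_D) :
  (0 < m)%N -> 0 <= l -> 0 < k ->
  (gauss_sample_exp theta (fun X : m.-tuple _ => (sqdist (soft_mean l X) theta)%:E) <=
   (3 / 2 * \sum_i (Num.min `|theta ord0 i| (2 * l)) ^+ 2 +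
    D%:R * (12 / k ^+ 2 * expR (k ^+ 2 / (2 * m%:R) - k * l)))%:E)%E.
Proof.
move=> m0 l0 k0.
have mR : m%:R != 0 :> R by rewrite pnatr_eq0 -lt0n.
have PI := prob_integral_gauss_sample theta m.
pose c0 i := 3 / 2 * (Num.min `|theta ord0 i| (2 * l)) ^+ 2.
pose cp i := 6 / k ^+ 2 * expR (- k * theta ord0 i - k * l).
pose cm i := 6 / k ^+ 2 * expR (k * theta ord0 i - k * l).
have c00 i : 0 <= c0 i by rewrite mulr_ge0// sqr_ge0.
have k6 : 0 <= 6 / k ^+ 2 by rewrite divr_ge0// sqr_ge0.
have cp0 i : 0 <= cp i by rewrite mulr_ge0// expR_ge0.
have cm0 i : 0 <= cm i by rewrite mulr_ge0// expR_ge0.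
pose ex (c : R) i (X : m.-tuple (D.-tuple R)) := (expR (c * coord_sum X i))%:E.
have mex c i : measurable_fun setT (ex c i).
  apply/measurable_EFinP; apply: measurableT_comp => //.
  by apply: measurable_funM => //; exact: measurable_coord_sum.
have ex0 c i X : (0 <= ex c i X)%E by rewrite lee_fin expR_ge0.
pose kp := k / m%:R; pose km := - k / m%:R.
pose b i X := ((c0 i)%:E + ((cp i)%:E * ex kp i X + (cm i)%:E * ex km i X))%E.
have mpm i : measurable_fun setT
    (fun X => (cp i)%:E * ex kp i X + (cm i)%:E * ex km i X)%E.
  by apply: emeasurable_funD; exact: measurable_funeM.
have pm0 i X : (0 <= (cp i)%:E * ex kp i X + (cm i)%:E * ex km i X)%E.
  by rewrite adde_ge0// mule_ge0// lee_fin.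
have mb i : measurable_fun setT (b i) by exact: emeasurable_funD.
have b0 i X : (0 <= b i X)%E by rewrite adde_ge0// lee_fin.
apply: (@le_trans _ _ (gauss_sample_exp theta (fun X => (\sum_i b i X)%E))).
  apply: (prob_integral_le PI).
  - apply/measurable_EFinP; apply: measurable_sum => i; apply: measurable_funX.
    apply: measurable_funB => //.
    by apply: (measurableT_comp (measurable_tnth i)); exact: measurable_soft_mean.
  - exact: emeasurable_sum.
  - by move=> X; rewrite lee_fin; apply: sumr_ge0 => i _; exact: sqr_ge0.
  - move=> X; rewrite /sqdist -sumEFin; apply: lee_sum => i _.
    rewrite /b /ex -!EFinM -!EFinD lee_fin tnth_mktuple.
    rewrite (_ : coord_sum X i / m%:R =
      theta ord0 i + (coord_sum X i / m%:R - theta ord0 i)); last by ring.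
    apply: le_trans (soft_error _ _ l0 k0) _.
    rewrite lerD2l mulrDr lerD//.
    + rewrite /cp -[leRHS]mulrA -expRD ler_wpM2l// ler_expR le_eqVlt; apply/orP; left.
      by apply/eqP; rewrite /kp; field.
    + rewrite /cm -[leRHS]mulrA -expRD ler_wpM2l// ler_expR le_eqVlt; apply/orP; left.
      by apply/eqP; rewrite /km; field.
rewrite (prob_integral_sum PI)//.
rewrite (_ : _ + _ = \sum_(i < D) (c0 i + 12 / k ^+ 2 * expR (k ^+ 2 / (2 * m%:R) - k * l))); last first.
  by rewrite big_split /= -mulr_sumr sumr_const card_ord -[X in _ = _ + X]mulr_natl.
rewrite -sumEFin; apply: lee_sum => i _.
rewrite /b (prob_integralD PI)//; last by move=> X; rewrite lee_fin.
rewrite (prob_integral_cst PI)// (prob_integralD PI)//; first last.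
- by move=> X; rewrite mule_ge0// lee_fin.
- by move=> X; rewrite mule_ge0// lee_fin.
- exact: measurable_funeM.
- exact: measurable_funeM.
rewrite !(prob_integralZ PI)// !gauss_sample_exp_mgf -!EFinM -!EFinD lee_fin lerD2l.
rewrite /cp /cm.
have E1 : expR (- k * theta ord0 i - k * l) *
    expR (m%:R * (kp * theta ord0 i + kp ^+ 2 / 2)) = expR (k ^+ 2 / (2 * m%:R) - k * l).
  by rewrite -expRD; congr expR; rewrite /kp; field.
have E2 : expR (k * theta ord0 i - k * l) *
    expR (m%:R * (km * theta ord0 i + km ^+ 2 / 2)) = expR (k ^+ 2 / (2 * m%:R) - k * l).
  by rewrite -expRD; congr expR; rewrite /km; field.
by rewrite -[X in X + _]mulrA E1 -[X in _ + X]mulrA E2 -mulrDl; lra.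
Qed.

End estimation.

(** * Truncated norms on [Gamma] under a valid test *)

Lemma expR_half_le2 {R : realType} : expR (1 / 2 : R) <= 2.
Proof.
rewrite -[1 / 2]opprK expRN -[leRHS]invrK lef_pV2 ?posrE ?expR_gt0 ?invr_gt0//.
by apply: le_trans (expR_ge1Dx _); lra.
Qed.

Section truncation.
Context {R : realType} (D : nat) (Gamma : set 'rV[R]_D) (eps : R) (n : nat).
Hypothesis oG : orthosymmetric Gamma.
Hypothesis cG : convex_set (Gamma : set (convex_lmodType 'rV[R]_D)).
Hypothesis eps0 : 0 < eps.
Hypothesis gof : gof_ok Gamma (eps / Num.sqrt 2) n.

Lemma le_norm2 (v : 'rV[R]_D) :
  (eps / Num.sqrt 2 <= norm2 v) = (eps ^+ 2 / 2 <= \sum_i v ord0 i ^+ 2).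
Proof.
have -> : eps / Num.sqrt 2 = Num.sqrt (eps ^+ 2 / 2).
  by rewrite sqrtrM ?sqr_ge0// sqrtr_sqr gtr0_norm// sqrtrV.
by rewrite /norm2 ler_sqrt// sumr_ge0// => i _; exact: sqr_ge0.
Qed.

(** Shrinking [v] to squared norm eps^2 / 2 keeps it in [Gamma] by solidity and on the boundary of
    the alternative, where [gof_fourth_moment] applies. *)
Lemma gof_rescale (theta v : 'rV[R]_D) : Gamma theta ->
  (forall i, `|v ord0 i| <= `|theta ord0 i|) ->
  eps ^+ 2 / 2 <= \sum_i v ord0 i ^+ 2 ->
  exists w : 'rV[R]_D, [/\ forall i, w ord0 i ^+ 2 <= v ord0 i ^+ 2,
    \sum_i w ord0 i ^+ 2 = eps ^+ 2 / 2 &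
    1 / 4 < n%:R ^+ 2 * \sum_i w ord0 i ^+ 4].
Proof.
move=> Gt vt; set q := \sum_i _ => hq.
have e2 : 0 < eps ^+ 2 / 2 by rewrite divr_gt0// exprn_gt0.
have q0 : 0 < q by exact: lt_le_trans hq.
pose a := Num.sqrt (eps ^+ 2 / 2 / q).
have a2 : a ^+ 2 = eps ^+ 2 / 2 / q by rewrite sqr_sqrtr// divr_ge0// ltW.
have a21 : a ^+ 2 <= 1 by rewrite a2 ler_pdivrMr// mul1r.
have a0 : 0 <= a by exact: sqrtr_ge0.
have a1 : a <= 1 by nra.
exists (a *: v).
have w2 : \sum_i (a *: v) ord0 i ^+ 2 = eps ^+ 2 / 2.
  under eq_bigr do rewrite mxE exprMn.
  by rewrite -mulr_sumr a2 divfK// gt_eqF.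
split => //.
  by move=> i; rewrite mxE exprMn ler_piMl// sqr_ge0.
have Gw : Gamma (a *: v).
  apply: (orthosymmetric_convex_solid oG cG Gt) => i.
  by rewrite mxE normrM (le_trans _ (vt i))// ger0_norm// ler_piMl.
have := gof_fourth_moment oG gof Gw; rewrite le_norm2 w2 lexx => /(_ isT) h.
(* Otherwise the exponent is at most 1/2, and 9/4 <= exp (1/2) <= 2 is absurd. *)
rewrite ltNge; apply/negP => h2.
have : expR (2 * n%:R ^+ 2 * \sum_i (a *: v) ord0 i ^+ 4) <= expR (1 / 2 : R).
  by rewrite ler_expR; lra.
have := @expR_half_le2 R.
lra.
Qed.

(** Were the truncated vector longer, its rescaling w would have |w_i| <= t, so n^2 sum w_i^4 <= n^2
    t^2 eps^2 / 2 <= 1/4, against [gof_rescale]. *)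
Lemma gof_truncated (t : R) (theta : 'rV[R]_D) : 0 <= t ->
  2 * n%:R ^+ 2 * eps ^+ 2 * t ^+ 2 <= 1 -> Gamma theta ->
  \sum_i (Num.min `|theta ord0 i| t) ^+ 2 <= eps ^+ 2 / 2.
Proof.
move=> t0 ht Gt; rewrite leNgt; apply/negP => h.
pose v : 'rV[R]_D := \row_i Num.min `|theta ord0 i| t.
have vE i : v ord0 i = Num.min `|theta ord0 i| t by rewrite mxE.
have v0 i : 0 <= v ord0 i by rewrite vE le_min normr_ge0.
have [|| w [wv w2 w4]] := @gof_rescale theta v Gt.
- by move=> i; rewrite ger0_norm// vE ge_min lexx.
- by under eq_bigr do rewrite vE; exact: ltW.
have : \sum_i w ord0 i ^+ 4 <= t ^+ 2 * (eps ^+ 2 / 2).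
  rewrite -w2 mulr_sumr; apply: ler_sum => i _.
  rewrite (_ : w ord0 i ^+ 4 = w ord0 i ^+ 2 * w ord0 i ^+ 2); last by ring.
  rewrite ler_wpM2r ?sqr_ge0// (le_trans (wv i))// lerXn2r ?nnegrE//.
  by rewrite vE ge_min lexx orbT.
move=> /(ler_wpM2l (sqr_ge0 (n%:R : R))); lra.
Qed.

(** With sum w_i^4 <= (sum w_i^2)^2 = eps^4 / 4, the bound of [gof_rescale] becomes 1 < (n
    eps^2)^2. *)
Lemma gof_sample_size (theta : 'rV[R]_D) : Gamma theta ->
  eps / Num.sqrt 2 <= norm2 theta -> 1 < n%:R * eps ^+ 2.
Proof.
rewrite le_norm2 => Gt ht.
have [//| w [_ w2 w4]] := @gof_rescale theta theta Gt _ ht.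
have w40 : \sum_i w ord0 i ^+ 4 <= (eps ^+ 2 / 2) ^+ 2.
  rewrite -w2 expr2 mulr_suml; apply: ler_sum => i _.
  rewrite (_ : w ord0 i ^+ 4 = w ord0 i ^+ 2 * w ord0 i ^+ 2); last by ring.
  rewrite ler_wpM2l ?sqr_ge0// (bigD1 i)//= lerDl.
  by apply: sumr_ge0 => j _; exact: sqr_ge0.
have := ler_wpM2l (sqr_ge0 (n%:R : R)) w40 => h.
have n0 : 0 <= n%:R * eps ^+ 2 by rewrite mulr_ge0// sqr_ge0.
rewrite -(@ltr_pXn2r _ 2) ?nnegrE// expr1n; lra.
Qed.

End truncation.

(** * Estimators and their sample sizes *)

Lemma ln_double_ge {R : realType} D : (0 < D)%N -> 1 / 2 <= ln (2 * D%:R) :> R.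
Proof.
move=> D0; have D1 : 1 <= D%:R :> R by rewrite ler1n.
rewrite -ler_expR lnK ?posrE; last by lra.
by apply: (le_trans expR_half_le2); lra.
Qed.

(** The zero estimator uses no sample and has risk |theta|^2. *)
Lemma est_ok_small {R : realType} D (Gamma : set 'rV[R]_D) (eps : R) :
  (forall theta, Gamma theta -> \sum_i theta ord0 i ^+ 2 <= eps ^+ 2) ->
  est_ok Gamma eps 0.
Proof.
move=> h; exists (fun=> [tuple 0 | i < D]); split; first exact: measurable_cst.
move=> theta Gt; rewrite lee_fin /= (le_trans _ (h _ Gt))//.
by apply: ler_sum => i _; rewrite tnth_mktuple sub0r sqrrN.
Qed.

(** [A] stands for n^2 eps^2, n being the sample size of the test; the hypothesis on truncations is
    what [gof_truncated] supplies. *)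
Lemma est_ok_soft {R : realType} D (Gamma : set 'rV[R]_D) (eps A : R) (m : nat) :
  (0 < D)%N -> 0 < eps -> 1 <= A -> 1 <= A * eps ^+ 2 ->
  (forall (t : R) theta, 0 <= t -> 2 * A * t ^+ 2 <= 1 -> Gamma theta ->
     \sum_i (Num.min `|theta ord0 i| t) ^+ 2 <= eps ^+ 2 / 2) ->
  32 * ln (2 * D%:R) * A <= m%:R -> est_ok Gamma eps m.
Proof.
move=> D0 e0 A1 Ae hG hm.
have D1 : 1 <= D%:R :> R by rewrite ler1n.
set L := ln _ in hm.
have L1 : 1 / 2 <= L by exact: ln_double_ge.
have A0 : 0 < A by lra.
have m16 : 16 <= m%:R :> R by nra.
have m0 : (0 < m)%N by rewrite -(ltr_nat R); lra.
(* With this threshold 2 l is the largest admissible t: 2 A (2 l)^2 = 1. *)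
pose l := Num.sqrt (8 * A)^-1.
have l2 : l ^+ 2 = (8 * A)^-1 by rewrite sqr_sqrtr// invr_ge0 mulr_ge0// ltW.
have l2A : 8 * A * l ^+ 2 = 1 by rewrite l2 divff// gt_eqF// mulr_gt0.
have l0 : 0 < l by rewrite sqrtr_gt0 invr_gt0 mulr_gt0.
have ml : 4 * L <= m%:R * l ^+ 2.
  apply: (@le_trans _ _ (32 * L * A * l ^+ 2)); first by nra.
  by rewrite ler_wpM2r// sqr_ge0.
exists (@soft_mean R D m l); split; first exact: measurable_soft_mean.
move=> theta Gt.
(* The choice k = m l minimises k^2 / (2 m) - k l, with minimum -m l^2 / 2 <= -2 L. *)
have k0 : 0 < m%:R * l by rewrite mulr_gt0// ltr0n.
apply: le_trans (soft_mean_risk theta m0 (ltW l0) k0) _; rewrite lee_fin.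
have h1 : \sum_i (Num.min `|theta ord0 i| (2 * l)) ^+ 2 <= eps ^+ 2 / 2.
  by apply: hG => //; [rewrite mulr_ge0// ltW|rewrite exprMn; lra].
have -> : (m%:R * l) ^+ 2 / (2 * m%:R) - m%:R * l * l = - (m%:R * l ^+ 2 / 2).
  by field; rewrite pnatr_eq0 -lt0n.
have h2 : expR (- (m%:R * l ^+ 2 / 2)) <= (2 * D%:R)^-1.
  rewrite -[in leRHS](@lnK _ (2 * D%:R)) ?posrE; last by lra.
  by rewrite -expRN ler_expR -/L; lra.
(* Multiplying m >= 32 L A by m l^2 >= 4 L gives 128 L^2 A, and L >= 1/2. *)
have kk : 32 * A <= (m%:R * l) ^+ 2.
  rewrite exprMn expr2 -mulrA.
  apply: (@le_trans _ _ ((32 * L * A) * (4 * L))).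
    have LL : 1 / 4 <= L * L by nra.
    by have := ler_wpM2l (ltW A0) LL; lra.
  by apply: ler_pM => //; nra.
have h3 : 12 / (m%:R * l) ^+ 2 <= 3 / 8 * eps ^+ 2.
  rewrite ler_pdivrMr ?exprn_gt0//; have := exprn_gt0 2 e0; nra.
have h4 : D%:R * (12 / (m%:R * l) ^+ 2 * expR (- (m%:R * l ^+ 2 / 2))) <=
    D%:R * (3 / 8 * eps ^+ 2 * (2 * D%:R)^-1).
  by rewrite ler_pM2l ?ltr0n// ler_pM// ?expR_ge0// divr_ge0// sqr_ge0.
have h5 : D%:R * (3 / 8 * eps ^+ 2 * (2 * D%:R)^-1) = 3 / 16 * eps ^+ 2.
  by field; rewrite pnatr_eq0 -lt0n.
(* The truncated part costs at most 3/4 eps^2 and the noise at most 3/16 eps^2. *)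
have := sqr_ge0 eps; lra.
Qed.

(** * Comparison of the two sample sizes *)

Theorem mainTheorem3 (R : realType) (D : nat) (Gamma : set 'rV[R]_D)
  (eps : R) (n_gof n_est : nat) :
  (0 < D)%N ->
  orthosymmetric Gamma -> compact Gamma ->
  convex_set (Gamma : set (convex_lmodType 'rV[R]_D)) ->
  0 < eps ->
  is_least_nat (gof_ok Gamma (eps / Num.sqrt 2)) n_gof ->
  is_least_nat (est_ok Gamma eps) n_est ->
  (64 * ln (2 * D%:R))^-1 * (n_est%:R / eps ^+ 2) <= (n_gof%:R : R) ^+ 2.
Proof.
move=> D0 oG _ cG e0 [gof _] [_ est].
have D1 : 1 <= D%:R :> R by rewrite ler1n.
have L0 : 0 < ln (2 * D%:R) :> R by rewrite ln_gt0//; lra.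
(* If no point of [Gamma] reaches the alternative, the zero estimator succeeds, [n_est] is 0 and the
   bound is trivial. *)
have [[theta [Gt ht]]|small] :=
    pselect (exists theta, Gamma theta /\ eps / Num.sqrt 2 <= norm2 theta); last first.
  have /est : est_ok Gamma eps 0.
    apply: est_ok_small => theta Gt; have [h|h] := leP (\sum_i theta ord0 i ^+ 2) (eps ^+ 2 / 2).
      by apply: (le_trans h); have := sqr_ge0 eps; lra.
    by exfalso; apply: small; exists theta; rewrite le_norm2// ltW.
  by rewrite leqn0 => /eqP ->; rewrite mul0r mulr0 sqr_ge0.
(* Since an alternative exists, n eps^2 > 1; this makes A = n^2 eps^2 and A eps^2 = (n eps^2)^2 at
   least 1. *)
have ne := gof_sample_size oG cG e0 gof Gt ht.
have n0 : (0 < n_gof)%N.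
  by rewrite lt0n; apply/negP => /eqP n0; move: ne; rewrite n0 mul0r ltr10.
have n1 : 1 <= n_gof%:R :> R by rewrite ler1n.
set nR : R := n_gof%:R in ne n1 *.
pose A := nR ^+ 2 * eps ^+ 2.
have A1 : 1 <= A by rewrite /A expr2 -mulrA; nra.
have Ae : 1 <= A * eps ^+ 2.
  by rewrite /A (_ : _ * _ = (nR * eps ^+ 2) ^+ 2); [nra|ring].
pose B := 64 * ln (2 * D%:R) * A.
have B0 : 0 <= B by rewrite !mulr_ge0 ?sqr_ge0// ltW.
(* By minimality [n_est] is at most the integer part of [B], hence at most [B], which is the claim
   rearranged. *)
suff /est : est_ok Gamma eps (Num.truncn B).
  rewrite -(ler_nat R) => h; have := le_trans h (proj1 (andP (truncn_itv B0))) => {}h.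
  rewrite mulrC ler_pdivrMr ?mulr_gt0// ler_pdivrMr ?exprn_gt0//.
  by apply: (le_trans h); rewrite /B /A le_eqVlt; apply/orP; left; apply/eqP; ring.
apply: (est_ok_soft (A := A)) => //.
  move=> t theta' t0 tA; apply: (gof_truncated oG cG e0 gof) => //.
  by move: tA; rewrite /A mulrA.
(* Rounding down loses less than 1, which 32 log (2 D) A >= 1 absorbs; hence 64 in place of the 32
   of [est_ok_soft]. *)
have := truncnS_gt B; rewrite -natr1 => hB.
have L1 : 1 / 2 <= ln (2 * D%:R) :> R by exact: ln_double_ge.
have : 1 <= 32 * ln (2 * D%:R) * A by nra.
rewrite /B in hB *; lra.
Qed.
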